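(* Suppose each $f_i$ is differentiable, has Lipschitz continuous gradient with constant $L_{f_i}\ge0$, and is strongly convex with parameter $\nu_{f_i}>0$ (i.e. $f_i(x)-\frac{\nu_{f_i}}2x^2$ is convex), and put $\nu=\min_i\nu_{f_i}$, $L=\max_iL_{f_i}$, $\kappa_f=L/\nu$. Use the standard graph Laplacian as the communication matrix in the multiagent distributed ADMM algorithm described in the context. Then, for a suitable choice of the penalty parameter $c>0$, in order to reach an $\epsilon$-optimal solution, i.e. to have $\|\mathbf{x}(t)-\mathbf{x}^*\|_2\le\epsilon$, $$O\left(\sqrt{\kappa_f}\,\sqrt{\frac{d_{\max}^4}{d_{\min}\,a^2(G)}}\,\log\left(\frac1\epsilon\right)\right)$$ iterations suffice.
   Context: Setting. Let $n\ge 2$ and let $G=(V,E)$ be a connected undirected simple graph with $V=\{1,\dots,n\}$. $N(i)$ is the set of neighbors of $i$ together with $i$ itself, $d_i=|N(i)|-1$ is the degree of $i$, $d_{\max}=\max_id_i$, $d_{\min}=\min_id_i$. For each $i$, $f_i:\mathbb{R}\to\mathbb{R}$ is convex (dimension one is taken for notational simplicity), and $F(\mathbf{x})=\sum_{i=1}^n f_i(x_i)$ for $\mathbf{x}=(x_1,\dots,x_n)\in\mathbb{R}^n$. The communication matrix is the Laplacian $A$ of $G$: $A_{ij}=-1$ for $j\in N(i)\setminus\{i\}$, $A_{ii}=d_i$, and $A_{ij}=0$ otherwise; since $G$ is connected, its null space is spanned by the all-ones vector. $a(G)$ is the algebraic connectivity of $G$, i.e. the smallest non-zero eigenvalue of $A$.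 The problem $\min\{F(\mathbf{x}): A\mathbf{x}=0\}$ is assumed to have an optimal solution; $\mathbf{x}^*$ denotes it (it is unique under the strong convexity assumption). Algorithm (penalty parameter $c>0$). Start from any initial values $x_i(0),y_i(0),p_i(0)\in\mathbb{R}$, $i=1,\dots,n$. For $t=0,1,2,\dots$ and all $i$: (1) $x_i(t+1)\in\arg\min_{x_i\in\mathbb{R}} f_i(x_i)+\sum_{j\in N(i)}\left(p_j(t)A_{ji}x_i+\frac c2\left|y_j(t)+A_{ji}(x_i-x_i(t))\right|^2\right)$; (2) $y_i(t+1)=\frac{1}{d_i+1}\sum_{j\in N(i)}A_{ij}x_j(t+1)$; (3) $p_i(t+1)=p_i(t)+c\,y_i(t+1)$. *)

(* Defs.v *)
From HB Require Import structures.
From mathcomp Require Import all_boot all_order all_algebra.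
From mathcomp Require Import all_classical all_reals all_analysis.
Import Order.TTheory GRing.Theory Num.Theory.
Import numFieldNormedType.Exports.

Set Implicit Arguments.
Unset Strict Implicit.
Unset Printing Implicit Defensive.

Local Open Scope classical_set_scope.
Local Open Scope ring_scope.

(* The graph is a symmetric irreflexive relation e on the vertex set 'I_n. *)
Section Graph.
Context (n : nat) (e : rel 'I_n).

Definition simple_graph : Prop := symmetric e /\ irreflexive e.

Definition connected_graph : Prop := forall i j, connect e i j.

(* Closed neighbourhood: it contains i. *)
Definition nbh (i : 'I_n) : {set 'I_n} := [set j | (j == i) || e i j].

Definition degree (i : 'I_n) : nat := #|nbh i| - 1.

Definition dmax : nat := \max_(i < n) degree i.

(* n exceeds every degree, so it is a neutral start value once 0 < n. *)
Definition dmin : nat := \big[minn/n]_(i < n) degree i.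

Context (R : realType).

Definition laplacian : 'M[R]_n :=
  \matrix_(i, j) if i == j then (degree i)%:R
                 else if j \in nbh i then -1 else 0.

Definition smallest_nonzero_eigenvalue (A : 'M[R]_n) (a : R) : Prop :=
  [/\ eigenvalue A a, a != 0 &
      forall b, eigenvalue A b -> b != 0 -> a <= b].

(* The default value 0 is never used when 2 <= n and the graph is connected. *)
Definition algebraic_connectivity : R :=
  xget 0 [set a | smallest_nonzero_eigenvalue laplacian a].

End Graph.

(* Extrema of a family over 'I_n; hn provides the first index. *)
Definition family_min (R : realType) (n : nat) (hn : (0 < n)%N)
  (h : 'I_n -> R) : R := \big[Num.min/h (Ordinal hn)]_(i < n) h i.

Definition family_max (R : realType) (n : nat) (hn : (0 < n)%N)
  (h : 'I_n -> R) : R := \big[Num.max/h (Ordinal hn)]_(i < n) h i.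

(* The norm `|_| that the library puts on matrices is the sup norm. *)
Definition norm2 (R : realType) (n : nat) (v : 'cV[R]_n) : R :=
  Num.sqrt (\sum_(i < n) v i 0 ^+ 2).

Definition strongly_convex (R : realType) (nu : R) (f : R -> R) : Prop :=
  convex_function [set: R] (fun x : R => f x - nu / 2 * x ^+ 2).

Definition is_argmin (R : realType) (g : R -> R) (z : R) : Prop :=
  forall w, g z <= g w.

Section Problem.
Context (R : realType) (n : nat) (f : 'I_n -> R -> R).

Definition objective (x : 'cV[R]_n) : R := \sum_(i < n) f i (x i 0).

Definition optimal_solution (A : 'M[R]_n) (xs : 'cV[R]_n) : Prop :=
  A *m xs = 0 /\ forall z, A *m z = 0 -> objective xs <= objective z.

(* x, y, p form a run from arbitrary initial values x 0, y 0, p 0. *)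
Definition admm_run (e : rel 'I_n) (A : 'M[R]_n) (c : R)
    (x y p : nat -> 'cV[R]_n) : Prop :=
  forall (t : nat) (i : 'I_n),
  [/\ is_argmin
        (fun xi : R => f i xi +
           \sum_(j in nbh e i)
             (p t j 0 * A j i * xi +
              c / 2 * `|y t j 0 + A j i * (xi - x t i 0)| ^+ 2))
        (x t.+1 i 0),
      y t.+1 i 0 = ((degree e i)%:R + 1)^-1 *
                   \sum_(j in nbh e i) A i j * x t.+1 j 0 &
      p t.+1 i 0 = p t i 0 + c * y t.+1 i 0].

End Problem.

(* Main.v *)
Require Import Defs.
From HB Require Import structures.
From mathcomp Require Import all_boot all_order all_algebra.
From mathcomp Require Import all_classical all_reals all_analysis.
From mathcomp Require Import ring lra.
Import Order.TTheory GRing.Theory Num.Theory.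
Import numFieldNormedType.Exports.

Set Implicit Arguments.
Unset Strict Implicit.
Unset Printing Implicit Defensive.

Local Open Scope classical_set_scope.
Local Open Scope ring_scope.

(** Let [A] be the Laplacian, [B] the diagonal matrix of the [d_i + 1],
    [S = A B^-1 A], and [M = Q - S], where [Q] is the diagonal of [A^T A].
    Write [e_t = x(t) - xs], [g_t] for the difference of the gradients of [F]
    at [x(t)] and at [xs], and [P] for the orthogonal projection onto the
    vectors with zero mean.  For [t >= 1] the multipliers enter the
    [x]-update only through [A p(t)], and because the gradient at [xs] has
    zero mean there is [u_t] of zero mean with
    [S u_t = A p(t) + grad F(xs)].  A run then becomes a primal-dual recursion
      [g_{t+1} + S u_{t+1} + c M (e_{t+1} - e_t) = 0],
      [u_{t+1} = u_t + c P e_{t+1}].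
    The matrix [M] is positive semidefinite by Cauchy-Schwarz on every closed
    neighbourhood, [M <= theta] with [theta = d_max^2 + d_max], and
    [S >= sigma] on vectors of zero mean with
    [sigma = a(G)^2 / (d_max + 1)].

    The natural energy [V = c <e, M e> + <u, S u> / c] decreases at each step
    by at least [2 <e, g>] plus quadratic terms in the increments, where
    [<e, g>] controls [|e|^2] by strong convexity and [|g|^2] by the Lipschitz
    gradient.  What is missing is a decrease in [u].  Recovering it from the
    increment of [e] would give a number of steps of order [theta / sigma];
    the square root is obtained instead from the cross term [<u, M e>]: the
    recursion gives
      [c (<u', M e'> - <u, M e>) = - <u', g'> - <u', S u'> + c^2 <P e', M e>],
    and the middle term is the missing one.  With
    [K = sqrt (kappa theta / sigma)], [c = K nu / theta] and
    [W = V + <u, M e> / (2 K)], Young inequalities absorb all other terms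
    ([lyapunov_step]), [W] is comparable to [V] ([lyapunov_energy]), and
    therefore [(1 + 1 / (5 K)) W' <= W] ([lyapunov_contraction]).  Thus [|e_t|]
    decays like [exp (- t / (12 K))], and [K] is at most twice the quantity in
    the theorem because [theta / sigma <= 4 d_max^3 / a(G)^2] and
    [d_min <= d_max].

    The bound [S >= sigma] needs the variational description of [a(G)]: the
    Rayleigh quotient of [A] attains its minimum over vectors of zero mean by
    compactness, a minimiser is an eigenvector, and every eigenvector with
    nonzero eigenvalue has zero mean. *)

(** * Differentiable convex functions of one variable *)

Section OneDimensionalCalculus.
Context {R : realType}.
Implicit Types (f h : R -> R) (x y z w : R).
Local Notation "f ^`()" := (derive1 f) : ring_scope.

Lemma derive1_argmin f z :
  (forall x, derivable f x 1) -> is_argmin f z -> f^`() z = 0.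
Proof.
move=> df fz.
have zI : z \in `]z - 1, z + 1[%R by rewrite in_itv /=; apply/andP; split; lra.
have := @derive1_at_min R f (z - 1) (z + 1) z _ (fun t _ => df t) zI
  (fun t _ => fz t).
by rewrite derive1E => /(_ _)[]//; lra.
Qed.

(** The local problems of the algorithm have this shape once their penalty
    terms are expanded in powers of the unknown. *)
Lemma argmin_quadratic_perturbation f (b c z : R) :
  (forall x, derivable f x 1) ->
  is_argmin (fun w => f w + (b * w + c * w ^+ 2)) z ->
  f^`() z + (b + 2 * c * z) = 0.
Proof.
move=> df zmin.
pose g w := f w + (b * w + c * w ^+ 2).
have dg w : is_derive w 1 g (f^`() w + (b + 2 * c * w)).
  have dfw : is_derive w 1 f (f^`() w) by rewrite derive1E; exact/derivableP.
  by apply: is_derive_eq; rewrite /GRing.scale /= !mulr1; ring.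
have := @derive1_argmin g z (fun w => @ex_derive _ _ _ _ _ _ _ (dg w)) zmin.
by rewrite derive1E derive_val.
Qed.

(** Along the segment from [x] to [y], convexity bounds every difference
    quotient at [x] by [h y - h x]; the derivative is their limit. *)
Lemma convex_tangent h x y :
  (forall x, derivable h x 1) -> convex_function [set: R] h ->
  h^`() x * (y - x) <= h y - h x.
Proof.
move=> dh ch.
have diffh : differentiable h x by exact/derivable1_diffP.
have -> : h^`() x * (y - x) = 'D_(y - x) h x.
  by rewrite deriveE // diff1E // mulrC.
have dv : derivable h x (y - x) by exact: diff_derivable.
have hcvg : (fun t : R => t^-1 *: ((h \o shift x) (t *: (y - x)) - h x)) @ 0^'+
    --> 'D_(y - x) h x.
  by apply: cvg_dnbhs_at_right; exact: dv.
apply: (cvgr_to_le hcvg).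
near=> t.
have t0 : 0 < t by [].
have t1 : t <= 1 by near: t; apply: nbhs_right_le.
have := ch (Itv01 (ltW t0) t1) y x (in_setT _) (in_setT _).
rewrite convRE /conv /= /unstable.onem => ht.
rewrite [leLHS]/GRing.scale /= mulrC ler_pdivrMr //.
rewrite (_ : t *: (y - x) + x = t * y + (1 - t) * x); last first.
  by rewrite /GRing.scale /=; ring.
move: ht; rewrite /GRing.scale /=; lra.
Unshelve. all: by end_near.
Qed.

(** The two tangent inequalities of [f - nu / 2 x^2], at [x] and at [y],
    add up to this. *)
Lemma strongly_convex_monotone (nu : R) f x y :
  (forall x, derivable f x 1) -> strongly_convex nu f ->
  nu * (x - y) ^+ 2 <= (x - y) * (f^`() x - f^`() y).
Proof.
move=> df cf.
pose h w := f w - nu / 2 * w ^+ 2.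
have dh w : is_derive w 1 h (f^`() w - nu * w).
  have dfw : is_derive w 1 f (f^`() w) by rewrite derive1E; exact/derivableP.
  by apply: is_derive_eq; rewrite /GRing.scale /= !mulr1; field.
have h'E w : h^`() w = f^`() w - nu * w by rewrite derive1E derive_val.
have dh1 w : derivable h w 1 by exact: (@ex_derive _ _ _ _ _ _ _ (dh w)).
have := convex_tangent x y dh1 cf; have := convex_tangent y x dh1 cf.
by rewrite !h'E; nra.
Qed.

(** Cocoercivity takes no convex analysis in dimension one: for a monotone
    function the product on the right is already an absolute value. *)
Lemma lipschitz_cocoercive (L : R) (g : R -> R) x y :
  0 <= L -> L.-lipschitz g -> 0 <= (x - y) * (g x - g y) ->
  (g x - g y) ^+ 2 <= L * ((x - y) * (g x - g y)).
Proof.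
move=> L0 gL mono.
have := gL (x, y) (conj I I) => /= gLxy.
rewrite -[leLHS]ger0_norm ?sqr_ge0 // -(ger0_norm mono) normrX normrM expr2.
by rewrite mulrA ler_wpM2r.
Qed.

End OneDimensionalCalculus.

(** * Quadratic forms on column vectors *)

Section EuclideanForms.
Context {R : realType} {n : nat}.
Implicit Types (u v w : 'cV[R]_n) (A M S : 'M[R]_n).

Definition dot u v : R := \sum_(i < n) u i 0 * v i 0.

Lemma dotC u v : dot u v = dot v u.
Proof. by apply: eq_bigr => i _; rewrite mulrC. Qed.

Lemma dotDl u v w : dot (u + v) w = dot u w + dot v w.
Proof. by rewrite -big_split; apply: eq_bigr => i _; rewrite mxE mulrDl. Qed.

Lemma dotZl (k : R) u v : dot (k *: u) v = k * dot u v.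
Proof. by rewrite mulr_sumr; apply: eq_bigr => i _; rewrite mxE mulrA. Qed.

Lemma dotNl u v : dot (- u) v = - dot u v.
Proof. by rewrite -scaleN1r dotZl mulN1r. Qed.

Lemma dotDr u v w : dot w (u + v) = dot w u + dot w v.
Proof. by rewrite dotC dotDl !(dotC w). Qed.

Lemma dotZr (k : R) u v : dot u (k *: v) = k * dot u v.
Proof. by rewrite dotC dotZl dotC. Qed.

Lemma dotNr u v : dot u (- v) = - dot u v.
Proof. by rewrite dotC dotNl dotC. Qed.

Lemma dot0r u : dot u 0 = 0.
Proof. by rewrite -(scale0r 0) dotZr mul0r. Qed.

Definition dotE := (dotDl, dotDr, dotZl, dotZr, dotNl, dotNr).

Lemma dot_ge0 u : 0 <= dot u u.
Proof. by apply: sumr_ge0 => i _; rewrite -expr2 sqr_ge0. Qed.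

Lemma dot_eq0 u : dot u u = 0 -> u = 0.
Proof.
move=> u0; apply/colP => i; rewrite mxE.
have /eqP : u i 0 * u i 0 = 0.
  by apply: (psumr_eq0P _ u0) => // j _; rewrite -expr2 sqr_ge0.
by rewrite mulf_eq0 orbb => /eqP.
Qed.

Lemma dot_delta u i : dot u (delta_mx i 0) = u i 0.
Proof.
rewrite /dot (bigD1 i) //= big1 => [|j /negbTE ji].
  by rewrite mxE !eqxx mulr1 addr0.
by rewrite mxE ji mulr0.
Qed.

Lemma norm2_dot u : norm2 u = Num.sqrt (dot u u).
Proof. by congr Num.sqrt; apply: eq_bigr => i _; rewrite expr2. Qed.

Lemma dot_tr A u v : dot (A *m u) v = dot u (A^T *m v).
Proof.
rewrite /dot (eq_bigr (fun i => \sum_j A i j * u j 0 * v i 0)); last first.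
  by move=> i _; rewrite mxE mulr_suml.
rewrite exchange_big; apply: eq_bigr => j _; rewrite mxE mulr_sumr.
by apply: eq_bigr => i _; rewrite mxE mulrCA mulrA.
Qed.

Lemma dot_sym A u v : A^T = A -> dot (A *m u) v = dot u (A *m v).
Proof. by move=> sA; rewrite dot_tr sA. Qed.

Definition psd M := M^T = M /\ forall v, 0 <= dot v (M *m v).

Lemma psd1 : psd 1%:M.
Proof. by split=> [|v]; rewrite ?trmx1 // mul1mx dot_ge0. Qed.

(** Expand the form of [M] at [r u - v]. *)
Lemma young M u v (r : R) : psd M -> 0 < r ->
  2 * dot u (M *m v) <= r * dot u (M *m u) + r^-1 * dot v (M *m v).
Proof.
move=> [sM pM] r0; have := pM (r *: u - v).
rewrite mulmxBr -scalemxAr !dotE -(dot_sym v u sM) (dotC (M *m v)).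
set a := dot u _; set b := dot u _; set d := dot v _ => h.
rewrite -(ler_pM2l r0) mulrDr mulrA [r * (r^-1 * _)]mulrA mulfV ?gt_eqF//.
by nra.
Qed.

Lemma young1 u v (r : R) : 0 < r ->
  2 * dot u v <= r * dot u u + r^-1 * dot v v.
Proof. by move=> r0; have := young u v psd1 r0; rewrite !mul1mx. Qed.

Lemma dot_cauchy_schwarz u v : dot u v ^+ 2 <= dot u u * dot v v.
Proof.
have [->|u0] := eqVneq u 0.
  by rewrite dotC dot0r expr0n mulr_ge0 // dot_ge0.
have du : 0 < dot u u.
  by rewrite lt_neqAle dot_ge0 andbT eq_sym; apply: contra u0 => /eqP/dot_eq0->.
have := dot_ge0 (dot u u *: v - dot u v *: u).
by rewrite !dotE (dotC v u); nra.
Qed.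

Lemma sqr_sum_le (P : {set 'I_n}) (F : 'I_n -> R) :
  (\sum_(i in P) F i) ^+ 2 <= #|P|%:R * \sum_(i in P) F i ^+ 2.
Proof.
pose u : 'cV[R]_n := \col_i (i \in P)%:R.
pose v : 'cV[R]_n := \col_i (if i \in P then F i else 0).
have := dot_cauchy_schwarz u v.
have -> : dot u v = \sum_(i in P) F i.
  rewrite big_mkcond; apply: eq_bigr => i _; rewrite !mxE.
  by case: (i \in P); rewrite ?mul1r ?mul0r.
have -> : dot u u = #|P|%:R.
  rewrite -sum1_card natr_sum big_mkcond; apply: eq_bigr => i _; rewrite !mxE.
  by case: (i \in P); rewrite ?mul1r ?mul0r.
have -> : dot v v = \sum_(i in P) F i ^+ 2.
  rewrite big_mkcond; apply: eq_bigr => i _; rewrite !mxE.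
  by case: (i \in P); rewrite ?mul0r ?expr2.
by [].
Qed.

End EuclideanForms.

(** * The Lyapunov function of the primal-dual recursion *)

Section Lyapunov.
Context {R : realType} {n : nat} (S M : 'M[R]_n) (c K : R).
Implicit Types (e u v w g : 'cV[R]_n).

Definition energy e u : R := c * dot e (M *m e) + c^-1 * dot u (S *m u).

(** The weight [1 / (2 K)] balances two needs: large enough for the decrease
    in [u] brought by the cross term to match the rate [1 / K], small enough
    for that term to be dominated by the energy. *)
Definition lyapunov e u : R := energy e u + (2 * K)^-1 * dot u (M *m e).

Context (theta sigma nu L : R).
Hypotheses (psdS : psd S) (psdM : psd M).
Hypotheses (c0 : 0 < c) (K1 : 1 <= K) (sigma0 : 0 < sigma)
  (nu0 : 0 < nu).
Hypothesis M_le : forall v, dot v (M *m v) <= theta * dot v v.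
(* The first two say that c makes the ratios c theta / nu and L / (c sigma),
   which weigh the primal and the dual errors, both equal to K; hence
   K^2 = (L / nu) (theta / sigma), and the third amounts to nu <= L. *)
Hypotheses (c_theta : c * theta = K * nu) (L_c : L = K * c * sigma)
  (theta_K : theta <= K ^+ 2 * sigma).

Let K0 : 0 < K. Proof. exact: lt_le_trans ltr01 K1. Qed.

(** Young's inequality with parameter [1 / (K c)] bounds the cross term: the
    form of [M] at [u] is at most [theta / sigma <= K^2] times that of [S]. *)
Lemma lyapunov_energy e u : sigma * dot u u <= dot u (S *m u) ->
  3 * energy e u <= 4 * lyapunov e u <= 5 * energy e u.
Proof.
move=> Su.
have Kc0 : 0 < (K * c)^-1 by rewrite invr_gt0 mulr_gt0.
have uMu : dot u (M *m u) <= K ^+ 2 * dot u (S *m u).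
  apply: (le_trans (M_le u)).
  apply: (le_trans (ler_wpM2r (dot_ge0 u) theta_K)).
  by rewrite -mulrA ler_wpM2l // sqr_ge0.
have cross v : dot v (M *m v) = dot u (M *m u) ->
    2 * dot v (M *m e) <= K * energy e u.
  move=> vu; apply: (le_trans (young v e psdM Kc0)); rewrite vu invrK /energy.
  have := ler_wpM2l (ltW Kc0) uMu.
  rewrite (_ : _ * (K ^+ 2 * _) = K * (c^-1 * dot u (S *m u))); last first.
    by field; rewrite !gt_eqF.
  lra.
have /= h1 := cross u erefl.
have h2 : 2 * dot (- u) (M *m e) <= K * energy e u.
  by apply: cross; rewrite mulmxN !dotE opprK.
rewrite dotNl in h2.
have E : 4 * ((2 * K)^-1 * dot u (M *m e)) = K^-1 * (2 * dot u (M *m e)).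
  by field; rewrite gt_eqF.
have Ki : 0 < K^-1 by rewrite invr_gt0.
have := ler_wpM2l (ltW Ki) h1; have := ler_wpM2l (ltW Ki) h2.
rewrite mulrN !mulKf ?gt_eqF // -E /lyapunov => ? ?.
by apply/andP; split; lra.
Qed.

(** The proof computes the exact decrease, testing the stationarity equation
    against [e'] for the energy and against [u'] for the cross term.  Of the
    resulting [2 dot e' g], one half pays for the three Young inequalities.
    [w] stands for the centred [e']. *)
Lemma lyapunov_step e e' u u' w g :
  g + S *m u' + c *: (M *m (e' - e)) = 0 ->
  u' = u + c *: w -> S *m w = S *m e' -> dot w w <= dot e' e' ->
  sigma * dot u' u' <= dot u' (S *m u') ->
  nu * dot e' e' <= dot e' g -> dot g g <= L * dot e' g ->
  lyapunov e' u' <=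
    lyapunov e u - dot e' g - (4 * K * c)^-1 * dot u' (S *m u').
Proof.
move=> stat u'E Sw ww Su' nue gL.
have [sS pS] := psdS; have [sM pM] := psdM.
have [D DE] : {D | D = e' - e} by exists (e' - e).
rewrite -DE in stat.
have uE : u = u' - c *: w by rewrite u'E addrK.
have st v : dot v g + dot v (S *m u') + c * dot v (M *m D) = 0.
  by have := congr1 (dot v) stat; rewrite !dotE dot0r.
have lyapE : lyapunov e u - lyapunov e' u' =
    2 * dot e' g + c * dot D (M *m D) + c * dot w (S *m w)
    + (2 * K)^-1 * (c^-1 * (dot u' g + dot u' (S *m u'))
                    - c * dot w (M *m e') + c * dot w (M *m D)).
  have -> : dot u' g + dot u' (S *m u') = - (c * dot u' (M *m D)).
    by apply/eqP; rewrite -addr_eq0 st.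
  have -> : dot e' g = - (dot w (S *m u') + c * dot e' (M *m D)).
    apply/eqP; rewrite -addr_eq0 -(dot_sym _ _ sS) Sw (dot_sym _ _ sS) addrA.
    by rewrite st.
  rewrite /lyapunov /energy uE DE !mulmxBr -!scalemxAr !dotE.
  rewrite -(dot_sym e e' sM) (dotC _ e') -(dot_sym u' w sS) (dotC _ w).
  by field; rewrite !gt_eqF.
have cM v : dot v v <= dot e' e' -> c * dot v (M *m v) <= K * dot e' g.
  move=> ve; apply: (le_trans (ler_wpM2l (ltW c0) (M_le v))).
  rewrite mulrA c_theta -mulrA ler_wpM2l ?(ltW K0) //.
  by apply: le_trans nue; rewrite ler_wpM2l ?(ltW nu0).
have Mee := cM e' (lexx _); have Mww := cM w ww.
(* The centred error meets M e = M e' - M D; the second piece is paid by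
   the decrease c <D, M D> of the energy. *)
have Y2 := young w e' psdM ltr01; rewrite invr1 !mul1r in Y2.
have := young (- w) D psdM ltr01; rewrite mulmxN !dotE opprK invr1 !mul1r => Y3.
have Y1 : - (c^-1 * dot u' g) <= 2^-1 * (c^-1 * dot u' (S *m u'))
     + 2^-1 * (K * dot e' g).
  have := young1 (- u') g sigma0; rewrite !dotE opprK => Y.
  have {}Y : - (2 * dot u' g) <= dot u' (S *m u') + K * c * dot e' g.
    have : sigma^-1 * dot g g <= K * c * dot e' g.
      by rewrite ler_pdivrMl // (le_trans gL) // L_c; nra.
    lra.
  have ci0 : 0 < c^-1 by rewrite invr_gt0.
  have := ler_wpM2l (ltW ci0) Y; rewrite mulrDr.
  rewrite (_ : c^-1 * (K * c * _) = K * dot e' g); first by lra.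
  by field; rewrite gt_eqF.
have cY2 := ler_wpM2l (ltW c0) Y2; have cY3 := ler_wpM2l (ltW c0) Y3.
suff : dot e' g + (4 * K * c)^-1 * dot u' (S *m u')
    <= lyapunov e u - lyapunov e' u' by lra.
rewrite lyapE.
set X := (X in (2 * K)^-1 * X).
have XX : 2^-1 * (c^-1 * dot u' (S *m u')) - 2 * K * dot e' g
    - 2^-1 * (c * dot D (M *m D)) <= X by rewrite /X; lra.
have K20 : 0 <= (2 * K)^-1 by rewrite invr_ge0 mulr_ge0 // ltW.
have := ler_wpM2l K20 XX.
have -> : (2 * K)^-1 * (2^-1 * (c^-1 * dot u' (S *m u')) - 2 * K * dot e' g
    - 2^-1 * (c * dot D (M *m D))) = (4 * K * c)^-1 * dot u' (S *m u')
    - dot e' g - (4 * K)^-1 * (c * dot D (M *m D)).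
  by field; rewrite !gt_eqF.
have cD : 0 <= c * dot D (M *m D) by rewrite mulr_ge0 ?(ltW c0).
have K4 : (4 * K)^-1 <= 1 by rewrite invf_le1; have := K1; lra.
have := ler_wpM2r cD K4; rewrite mul1r.
have cw : 0 <= c * dot w (S *m w) by rewrite mulr_ge0 ?(ltW c0).
by lra.
Qed.

(** The decrease dominates [energy e' u' / (4 K)]: its first part since
    [c theta = K nu], its second part directly; and [energy] is comparable to
    [lyapunov].  The bound on [e'] follows as [lyapunov e' u'] is
    nonnegative. *)
Lemma lyapunov_contraction e e' u u' w g :
  g + S *m u' + c *: (M *m (e' - e)) = 0 ->
  u' = u + c *: w -> S *m w = S *m e' -> dot w w <= dot e' e' ->
  sigma * dot u' u' <= dot u' (S *m u') ->
  nu * dot e' e' <= dot e' g -> dot g g <= L * dot e' g ->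
  (1 + (5 * K)^-1) * lyapunov e' u' <= lyapunov e u /\
  nu * dot e' e' <= lyapunov e u.
Proof.
move=> stat u'E Sw ww Su' nue gL.
have := lyapunov_step stat u'E Sw ww Su' nue gL.
have /andP[W'ge W'le] := lyapunov_energy e' Su'.
have [_ pS] := psdS; have [_ pM] := psdM.
set W' := lyapunov e' u' in W'ge W'le *; set W := lyapunov e u.
have V'0 : 0 <= energy e' u'.
  by rewrite addr_ge0 // mulr_ge0 ?invr_ge0 ?(ltW c0).
have q0 : 0 <= (4 * K * c)^-1 * dot u' (S *m u').
  by rewrite mulr_ge0 // invr_ge0 !mulr_ge0 ?(ltW c0) // ltW.
have G0 : 0 <= dot e' g.
  by apply: le_trans nue; rewrite mulr_ge0 ?(ltW nu0) ?dot_ge0.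
have Me : c * dot e' (M *m e') <= K * dot e' g.
  apply: (le_trans (ler_wpM2l (ltW c0) (M_le e'))).
  by rewrite mulrA c_theta -mulrA ler_wpM2l // ltW.
have K40 : 0 <= (4 * K)^-1 by rewrite invr_ge0 mulr_ge0 // ltW.
have := ler_wpM2l K40 W'le; have := ler_wpM2l K40 Me.
rewrite (_ : (4 * K)^-1 * (4 * W') = 5 * ((5 * K)^-1 * W')); last first.
  by field; rewrite gt_eqF.
rewrite (_ : (4 * K)^-1 * (K * dot e' g) = 4^-1 * dot e' g); last first.
  by field; rewrite gt_eqF.
rewrite (_ : (4 * K)^-1 * (5 * energy e' u') =
    5 * ((4 * K)^-1 * (c * dot e' (M *m e')) +
    (4 * K * c)^-1 * dot u' (S *m u'))); last first.
  by rewrite /energy; field; rewrite !gt_eqF.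
by split; lra.
Qed.

End Lyapunov.

(** * From a contraction factor to an iteration count *)

Section LinearRate.
Context {R : realType}.

(** The constant [6] leaves room: [1 - 1 / (6 K)] is still at least the inverse
    of [1 + 1 / (5 K)] as soon as [1 <= K]. *)
Lemma geometric_decay (K : R) (W : nat -> R) :
  1 <= K -> (forall m, 0 <= W m) ->
  (forall m, (1 + (5 * K)^-1) * W m.+1 <= W m) ->
  forall m, W m <= expR (- (m%:R / (6 * K))) * W 0.
Proof.
move=> K1 W0 Wdec.
have K0 : 0 < K by exact: lt_le_trans ltr01 K1.
have q_le : (1 + (5 * K)^-1)^-1 <= expR (- (6 * K)^-1).
  apply: le_trans (expR_ge1Dx _).
  have d0 : 0 < 1 + (5 * K)^-1 by rewrite addr_gt0 // invr_gt0 mulr_gt0.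
  rewrite -div1r ler_pdivrMr // -subr_ge0.
  have -> : (1 - (6 * K)^-1) * (1 + (5 * K)^-1) - 1 = (K - 1) / (30 * K ^+ 2).
    by field; rewrite gt_eqF.
  by rewrite divr_ge0 ?subr_ge0 // mulr_ge0 // sqr_ge0.
elim=> [|m IH]; first by rewrite mul0r oppr0 expR0 mul1r.
have d0 : 0 < 1 + (5 * K)^-1 by rewrite addr_gt0 // invr_gt0 mulr_gt0.
apply: (@le_trans _ _ (expR (- (6 * K)^-1) * W m)).
  apply: le_trans (ler_wpM2r (W0 m) q_le).
  by rewrite ler_pdivlMl.
rewrite (_ : - (m.+1%:R / _) = - (6 * K)^-1 + - (m%:R / (6 * K))).
  by rewrite expRD -mulrA ler_wpM2l ?expR_ge0.
by rewrite -natr1; field; rewrite gt_eqF.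
Qed.

(** With [l = ln (1 / eps)], the hypothesis on [t] gives [t >= 18 K l], hence
    [d t ^+ 2] of order [eps ^+ 3]; the extra factor [eps] beats the initial
    constant [B / nu] for small [eps]. *)
Lemma linear_rate_complexity (K T nu B : R) (d : nat -> R) :
  1 <= K -> K <= 2 * T -> 0 < nu -> 0 <= B -> (forall t, 0 <= d t) ->
  (forall m, nu * d m.+2 ^+ 2 <= expR (- (m%:R / (6 * K))) * B) ->
  \forall eps \near (0 : R)^'+, forall t : nat,
    36 * (T * ln (1 / eps)) <= t%:R -> d t <= eps.
Proof.
move=> K1 KT nu0 B0 d_ge0 dec.
have K0 : 0 < K by exact: lt_le_trans ltr01 K1.
near=> eps.
have e0 : 0 < eps by [].
have e1 : eps <= expR (-1) by near: eps; apply: nbhs_right_le; exact: expR_gt0.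
have eB : eps <= nu / (expR 1 * (B + 1)).
  near: eps; apply: nbhs_right_le.
  by rewrite divr_gt0 // mulr_gt0 ?expR_gt0 // ltr_wpDl.
move=> t ht.
set l := ln (1 / eps) in ht.
have lE : eps = expR (- l) by rewrite /l div1r lnV ?posrE // opprK lnK.
have l1 : 1 <= l.
  by move: e1; rewrite lE ler_expR lerN2.
have tK : 18 * K * l <= t%:R.
  apply: le_trans ht; rewrite mulrA ler_wpM2r //; first exact: le_trans l1.
  by lra.
(* K and l are at least 1, so t is at least 18. *)
case: t => [|[|m]] in ht tK *; try nra.
have mK : 3 * l - 1 <= m%:R / (6 * K).
  rewrite ler_pdivlMr ?mulr_gt0 //.
  move: tK; rewrite -addn2 natrD; nra.
rewrite -(@ler_pXn2r _ 2) ?nnegrE ?(ltW e0) // -(ler_pM2l nu0).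
apply: (le_trans (dec m)).
apply: (@le_trans _ _ (expR (1 - 3 * l) * B)).
  by rewrite ler_wpM2r // ler_expR; lra.
have -> : expR (1 - 3 * l) = expR 1 * eps ^+ 3.
  by rewrite expRD lE -expRM_natl; congr (_ * expR _); ring.
move: eB; rewrite ler_pdivlMr ?mulr_gt0 ?expR_gt0 // ?ltr_wpDl // => eB.
have -> : expR 1 * eps ^+ 3 * B = (eps * (expR 1 * B)) * eps ^+ 2 by ring.
rewrite ler_wpM2r ?sqr_ge0 //; apply: le_trans eB.
by rewrite ler_wpM2l ?(ltW e0) // ler_wpM2l ?expR_ge0 // lerDl.
Unshelve. all: by end_near.
Qed.

End LinearRate.

(** * Symmetric matrices whose kernel is spanned by the all-ones vector *)

Section SymmetricMatricesAnnihilatingOnes.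
Context {R : realType} {n : nat}.
Implicit Types (u v w z : 'cV[R]_n) (A : 'M[R]_n).

Definition ones : 'cV[R]_n := const_mx 1.

Lemma dot_ones_ones : dot ones ones = n%:R.
Proof.
rewrite /dot (eq_bigr (fun=> 1)) => [|i _]; last by rewrite !mxE mulr1.
by rewrite sumr_const card_ord.
Qed.

Definition center v : 'cV[R]_n := v - (n%:R^-1 * dot ones v) *: ones.

Lemma dot_ones_center v : (0 < n)%N -> dot ones (center v) = 0.
Proof.
move=> n0; rewrite /center !dotE dot_ones_ones mulrAC mulVf ?mul1r ?subrr //.
by rewrite pnatr_eq0 -lt0n.
Qed.

Lemma mulmx_center A v : A *m ones = 0 -> A *m center v = A *m v.
Proof. by move=> A1; rewrite mulmxBr -scalemxAr A1 scaler0 subr0. Qed.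

Lemma dot_center_le v : (0 < n)%N -> dot (center v) (center v) <= dot v v.
Proof.
move=> n0; rewrite -subr_ge0 /center !dotE dot_ones_ones (dotC v ones).
set s := dot ones v; set k := dot v v.
have nN0 : n%:R != 0 :> R by rewrite pnatr_eq0 -lt0n.
rewrite (_ : k - (k + _ + _) = n%:R^-1 * s ^+ 2); last by field.
by rewrite mulr_ge0 ?invr_ge0 ?ler0n ?sqr_ge0.
Qed.

Definition kernel_ones A := A *m ones = 0 /\
  forall v, A *m v = 0 -> dot ones v = 0 -> v = 0.

Lemma dot_ones_mulmx A v : A^T = A -> kernel_ones A -> dot ones (A *m v) = 0.
Proof. by move=> sA [A1 _]; rewrite -dot_sym // A1 dotC dot0r. Qed.

Lemma kernel_onesE A v : (0 < n)%N -> kernel_ones A -> A *m v = 0 ->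
  v = (n%:R^-1 * dot ones v) *: ones.
Proof.
move=> n0 [A1 Ak] Av; apply/eqP; rewrite -subr_eq0; apply/eqP.
by apply: Ak; rewrite ?mulmx_center // dot_ones_center.
Qed.

(** The columns of the cokernel matrix of [A] lie in the kernel of [A], hence
    are constant, hence are orthogonal to [w]. *)
Lemma range_kernel_ones A w : (0 < n)%N -> A^T = A -> kernel_ones A ->
  dot ones w = 0 -> exists2 u, A *m u = w & dot ones u = 0.
Proof.
move=> n0 sA kA w1.
suff /submxP[D wD] : (w^T <= A)%MS.
  exists (center D^T); last exact: dot_ones_center.
  rewrite mulmx_center ?(proj1 kA) //.
  by apply: trmx_inj; rewrite trmx_mul trmxK sA -wD.
rewrite submxE; apply/eqP/matrixP => i j; rewrite [RHS]mxE.
have Aj : A *m col j (cokermx A) = 0.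
  by rewrite colE mulmxA mulmx_coker mul0mx.
have cj := kernel_onesE n0 kA Aj.
transitivity (dot w (col j (cokermx A))).
  by rewrite mxE /dot; apply: eq_bigr => k _; rewrite !mxE (ord1 i).
by rewrite cj dotZr (dotC w) w1 mulr0.
Qed.

Lemma continuous_dot (f g : 'rV[R]_n -> 'cV[R]_n) :
  (forall i, continuous (fun r => f r i 0)) ->
  (forall i, continuous (fun r => g r i 0)) ->
  continuous (fun r => dot (f r) (g r)).
Proof.
move=> cf cg; rewrite /dot.
apply: (@continuous_big R 'I_n +%R 0 xpredT add_continuous) => i _ r.
exact: (cvgM (cf i r) (cg i r)).
Qed.

(** The minimum is taken over the unit vectors orthogonal to [ones], a compact
    set; homogeneity extends the inequality to all vectors. *)
Lemma rayleigh_minimum A : (1 < n)%N ->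
  exists2 v, dot v v = 1 /\ dot ones v = 0 &
    forall w, dot ones w = 0 ->
      dot v (A *m v) * dot w w <= dot w (A *m w).
Proof.
move=> n1.
pose K := [set r : 'rV[R]_n | dot r^T r^T = 1] `&`
          [set r : 'rV[R]_n | dot ones r^T = 0].
have ct i : continuous (fun r : 'rV[R]_n => r^T i 0).
  rewrite (_ : (fun _ => _) = (fun r : 'rV[R]_n => r 0 i)).
    exact: coord_continuous.
  by apply/funext => r; rewrite mxE.
have cA i : continuous (fun r : 'rV[R]_n => (A *m r^T) i 0).
  rewrite (_ : (fun _ => _) = (fun r => dot (row i A)^T r^T)).
    by apply: continuous_dot ct => j; exact: cst_continuous.
  by apply/funext => r; rewrite /dot mxE; apply: eq_bigr => j _; rewrite !mxE.
have normalise w : w != 0 -> dot ones w = 0 ->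
    K ((Num.sqrt (dot w w))^-1 *: w)^T.
  move=> w0 w1.
  have dw : 0 < dot w w.
    by rewrite lt_neqAle dot_ge0 andbT eq_sym; apply: contra w0 => /eqP/dot_eq0->.
  split; rewrite /= trmxK !dotE ?w1 ?mulr0 //.
  by rewrite mulrA -invfM -expr2 sqr_sqrtr ?dot_ge0 // mulVf ?gt_eqF.
have level_closed (h : 'rV[R]_n -> R) k : continuous h ->
    closed [set r | h r = k].
  move=> ch; apply: (@preimage_closed _ _ h [set x | x = k]).
    by move=> r _; exact: ch.
  exact: closed_eq.
have KC : compact K.
  apply: bounded_closed_compact.
    exists 1; split => // b b1 r [/= r1 _]; apply: le_trans (ltW b1).
    rewrite [leLHS]/Num.norm /= mx_normrE; apply: bigmax_le => // -[k i] _ /=.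
    rewrite (ord1 k) -(@ler_pXn2r _ 2) ?nnegrE // expr1n real_normK ?num_real //.
    rewrite -r1 /dot (bigD1 i) //= !mxE -expr2 lerDl.
    by apply: sumr_ge0 => j _; rewrite -expr2 sqr_ge0.
  apply: closedI; apply: level_closed; first exact: continuous_dot.
  by apply: continuous_dot => // j; exact: cst_continuous.
have K0 : K !=set0.
  pose i0 : 'I_n := Ordinal (ltnW n1); pose i1 : 'I_n := Ordinal n1.
  pose w : 'cV[R]_n := delta_mx i0 0 - delta_mx i1 0.
  eexists; apply: (normalise w).
    by apply/eqP => /colP/(_ i0)/eqP; rewrite !mxE /= subr0 oner_eq0.
  by rewrite dotDr dotNr !dot_delta !mxE subrr.
have [r rK rmin] := @EVT_min_rV R n (fun r => dot r^T (A *m r^T)) K K0 KC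
  (continuous_subspaceT (continuous_dot ct cA)).
move: rK; rewrite inE => -[/= r1 r2]; exists r^T => // w w1.
have [->|w0] := eqVneq w 0; first by rewrite mulmx0 !dot0r mulr0.
have := rmin _ (mem_set (normalise w w0 w1)).
have dw : 0 < dot w w.
  by rewrite lt_neqAle dot_ge0 andbT eq_sym; apply: contra w0 => /eqP/dot_eq0->.
rewrite trmxK -scalemxAr !dotE mulrA -invfM -expr2 sqr_sqrtr ?dot_ge0 //.
by rewrite ler_pdivlMl // mulrC.
Qed.

(** First-order optimality, tested against the residual
    [z = A v - mu v] itself: the form of [A - mu] is nonnegative at [v + t z],
    which is a second-degree polynomial in [t] without constant term, so its
    linear coefficient [2 <z, z>] vanishes. *)
Lemma rayleigh_eigenvector A v : psd A -> kernel_ones A ->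
  dot v v = 1 -> dot ones v = 0 ->
  (forall w, dot ones w = 0 -> dot v (A *m v) * dot w w <= dot w (A *m w)) ->
  A *m v = dot v (A *m v) *: v.
Proof.
move=> [sA pA] kA v1 v0 vmin; set mu := dot v (A *m v) in vmin *.
have [z zE] : {z | z = A *m v - mu *: v} by eexists.
have z0 : dot ones z = 0.
  by rewrite zE !dotE dot_ones_mulmx // v0 mulr0 subr0.
have [q qE] : {q | q = dot z (A *m z) - mu * dot z z} by eexists.
have q0 : 0 <= q by rewrite qE subr_ge0 vmin.
have zz : dot z z = dot z (A *m v) - mu * dot z v.
  by have := congr1 (dot z) zE; rewrite !dotE.
(* The minimiser in t would be - <z, z> / q; adding 1 avoids the case q = 0. *)
pose t := - (dot z z / (q + 1)).
have := vmin (v + t *: z); rewrite !dotE v0 z0 mulr0 addr0 => /(_ erefl).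
rewrite mulmxDr -scalemxAr !dotE v1 -/mu -(dot_sym v z sA) (dotC (A *m v)) (dotC v z).
move=> h.
have {}h : 0 <= 2 * t * dot z z + t ^+ 2 * q.
  by rewrite qE zz; nra.
have q1 : 0 < q + 1 by lra.
have hE : 2 * t * dot z z + t ^+ 2 * q =
    - (dot z z ^+ 2 * (q + 2) / (q + 1) ^+ 2).
  by rewrite /t; field; rewrite gt_eqF.
have zz0 : dot z z ^+ 2 = 0.
  apply/eqP; rewrite eq_le sqr_ge0 andbT.
  move: h; rewrite hE oppr_ge0 pmulr_lle0 ?invr_gt0 ?exprn_gt0 //.
  by rewrite pmulr_lle0 //; lra.
apply/eqP; rewrite -subr_eq0 -zE; apply/eqP/dot_eq0/eqP.
by rewrite -sqrf_eq0 zz0.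
Qed.

Lemma smallest_nonzero_eigenvalue_rayleigh A : (1 < n)%N ->
  psd A -> kernel_ones A -> exists mu : R,
  [/\ smallest_nonzero_eigenvalue A mu, 0 < mu &
    forall w, dot ones w = 0 -> mu * dot w w <= dot w (A *m w)].
Proof.
move=> n1 psdA kA; have [sA pA] := psdA.
have [v [v1 v0] vmin] := rayleigh_minimum A n1.
have Av := rayleigh_eigenvector psdA kA v1 v0 vmin.
set mu := dot v (A *m v) in vmin Av.
have vN0 : v != 0.
  by apply/eqP => vE; move: v1; rewrite vE dot0r => /esym/eqP; rewrite oner_eq0.
have mu0 : mu != 0.
  apply: contra vN0 => /eqP muE; apply/eqP.
  by apply: (proj2 kA) => //; rewrite Av muE scale0r.
exists mu; split => //; last by rewrite lt_neqAle eq_sym mu0 pA.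
split => // [|b /eigenvalueP[r rb r0] b0].
  apply/eigenvalueP; exists v^T; last by rewrite trmx_eq0.
  by rewrite -[X in _ *m X]sA -trmx_mul Av linearZ.
have Ar : A *m r^T = b *: r^T by rewrite -[X in X *m _]sA -trmx_mul rb linearZ.
have r1 : dot ones r^T = 0.
  have := dot_ones_mulmx r^T sA kA; rewrite Ar dotZr => /eqP.
  by rewrite mulf_eq0 (negbTE b0) => /eqP.
have := vmin _ r1; rewrite Ar dotZr ler_pM2r //.
rewrite lt_neqAle dot_ge0 andbT eq_sym; apply: contra r0 => /eqP/dot_eq0 rE.
by rewrite -trmx_eq0 rE.
Qed.

End SymmetricMatricesAnnihilatingOnes.

(** * The graph Laplacian *)

Section GraphLaplacian.
Context {R : realType} {n : nat} (e : rel 'I_n).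
Hypotheses (n1 : (1 < n)%N) (simple_e : simple_graph e)
  (connected_e : connected_graph e).
Implicit Types (u v w : 'cV[R]_n).

Local Notation A := (laplacian e R).
Local Notation a := (algebraic_connectivity e R).

Lemma card_nbh i : #|nbh e i| = (degree e i).+1.
Proof.
rewrite /degree subn1 prednK //; apply/card_gt0P; exists i.
by rewrite inE eqxx.
Qed.

Lemma degreeE i : (degree e i)%:R = \sum_j (e i j)%:R :> R.
Proof.
have [_ irr] := simple_e.
rewrite -natr_sum; congr _%:R; apply/eqP; rewrite -eqSS -card_nbh -add1n.
have -> : nbh e i = i |: [set j | e i j] by apply/setP => j; rewrite !inE.
rewrite cardsU1 inE irr /=; apply/eqP; congr addn.
rewrite -sum1_card big_mkcond; apply: eq_bigr => j _.
by rewrite inE; case: (e i j).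
Qed.

Lemma laplacianE i j : A i j = (i == j)%:R * (degree e i)%:R - (e i j)%:R.
Proof.
have [_ irr] := simple_e; rewrite mxE inE.
have [->|ij] := eqVneq i j; first by rewrite irr mul1r subr0.
by rewrite mul0r sub0r /=; case: (e i j); rewrite ?oppr0.
Qed.

Lemma laplacian_sym : A^T = A.
Proof.
have [sym _] := simple_e; apply/matrixP => i j.
rewrite mxE !laplacianE sym eq_sym.
by have [->|] := eqVneq i j; rewrite ?mul0r.
Qed.

Lemma laplacian_out i j : j \notin nbh e i -> A i j = 0.
Proof.
rewrite inE negb_or => /andP[ji /negbTE eij].
by rewrite laplacianE eq_sym (negbTE ji) eij mul0r subr0.
Qed.

(** The updates sum over closed neighbourhoods, the matrix products over all
    vertices. *)
Lemma sum_nbh_laplacian i (F : R -> 'I_n -> R) : (forall j, F 0 j = 0) ->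
  \sum_(j in nbh e i) F (A i j) j = \sum_j F (A i j) j.
Proof.
move=> F0; rewrite big_mkcond; apply: eq_bigr => j _.
by case: ifP => // /negbT /laplacian_out ->; rewrite F0.
Qed.

Lemma mulmx_laplacian v i :
  (A *m v) i 0 = \sum_j (e i j)%:R * (v i 0 - v j 0).
Proof.
rewrite mxE (eq_bigr (fun j => (i == j)%:R * (degree e i)%:R * v j 0
    - (e i j)%:R * v j 0)); last by move=> j _; rewrite laplacianE mulrBl.
rewrite sumrB (bigD1 i) //= eqxx mul1r big1 => [|j]; last first.
  by rewrite eq_sym => /negbTE ->; rewrite !mul0r.
rewrite addr0 degreeE mulr_suml -sumrB.
by apply: eq_bigr => j _; rewrite mulrBr.
Qed.

Lemma laplacian_form v :
  2 * dot v (A *m v) = \sum_i \sum_j (e i j)%:R * (v i 0 - v j 0) ^+ 2.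
Proof.
have [sym _] := simple_e.
have E : dot v (A *m v) = \sum_i \sum_j v i 0 * ((e i j)%:R * (v i 0 - v j 0)).
  by apply: eq_bigr => i _; rewrite mulmx_laplacian mulr_sumr.
rewrite mulrDl mul1r [X in X + _]E [X in _ + X]E [X in _ + X]exchange_big.
rewrite -big_split /=.
apply: eq_bigr => i _; rewrite -big_split; apply: eq_bigr => j _ /=.
by rewrite (sym j i); ring.
Qed.

Lemma laplacian_psd : psd A.
Proof.
split=> [|v]; first exact: laplacian_sym.
rewrite -(@pmulr_rge0 _ 2) // laplacian_form.
by do 2!apply: sumr_ge0 => ? _; rewrite mulr_ge0 ?sqr_ge0.
Qed.

(** The form vanishes only if the vector agrees along every edge, hence, by
    connectivity, everywhere. *)
Lemma laplacian_kernel : kernel_ones A.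
Proof.
split=> [|v Av v1].
  apply/colP => i; rewrite mulmx_laplacian [RHS]mxE big1 // => j _.
  by rewrite !mxE subrr mulr0.
have form0 : \sum_i \sum_j (e i j)%:R * (v i 0 - v j 0) ^+ 2 = 0.
  by rewrite -laplacian_form Av dot0r mulr0.
have edge i j : e i j -> v i 0 = v j 0.
  have ge0 i' j' : 0 <= (e i' j')%:R * (v i' 0 - v j' 0) ^+ 2.
    by rewrite mulr_ge0 ?sqr_ge0.
  have /(_ _ isT) row0 := psumr_eq0P (fun k _ => sumr_ge0 _ (fun j _ => ge0 k j)) form0.
  have : (e i j)%:R * (v i 0 - v j 0) ^+ 2 = 0.
    exact: (psumr_eq0P (fun k _ => ge0 i k) (row0 i)).
  by move=> + eij; rewrite eij mul1r => /eqP; rewrite sqrf_eq0 subr_eq0 => /eqP.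
have const i j : v i 0 = v j 0.
  have /connectP[p + ->] := connected_e i j.
  elim: p i => //= k p IH i /andP[/edge -> pth]; exact: IH.
apply/colP => i; rewrite mxE.
move: v1; rewrite /dot (eq_bigr (fun=> v i 0)) => [|j _].
  rewrite sumr_const card_ord => /eqP; rewrite mulrn_eq0.
  by rewrite (gtn_eqF (ltnW n1)) => /eqP.
by rewrite mxE mul1r; exact: const.
Qed.

(** [smallest_nonzero_eigenvalue] determines its value, so [a] is the minimum
    of the Rayleigh quotient. *)
Lemma algebraic_connectivity_gap :
  0 < a /\ forall w, dot ones w = 0 -> a * dot w w <= dot w (A *m w).
Proof.
have [mu [mumin mu0 gap]] :=
  smallest_nonzero_eigenvalue_rayleigh n1 laplacian_psd laplacian_kernel.
have [mue muN0 mu_le] := mumin.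
have [ae aN0 a_le] : smallest_nonzero_eigenvalue A a.
  by apply: xgetPex; exists mu.
suff -> : a = mu by [].
by apply/eqP; rewrite eq_le a_le // mu_le.
Qed.

(** Cauchy-Schwarz applied to [dot w (A *m w)]. *)
Lemma algebraic_connectivity_le_norm w : dot ones w = 0 ->
  a ^+ 2 * dot w w <= dot (A *m w) (A *m w).
Proof.
have [a0 gap] := algebraic_connectivity_gap => w1.
have [->|wN0] := eqVneq w 0; first by rewrite dot0r mulr0 dot_ge0.
have dw : 0 < dot w w.
  by rewrite lt_neqAle dot_ge0 andbT eq_sym; apply: contra wN0 => /eqP/dot_eq0->.
rewrite -(ler_pM2l dw); apply: le_trans (dot_cauchy_schwarz _ _).
rewrite mulrCA -expr2 -exprMn.
by rewrite ler_pXn2r ?gap // nnegrE ?mulr_ge0 ?(ltW a0) ?dot_ge0 //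
  (le_trans _ (gap w w1)) // mulr_ge0 ?dot_ge0 // ltW.
Qed.

Lemma degree_gt0 i : (0 < degree e i)%N.
Proof.
pose j : 'I_n := if i == Ordinal n1 then Ordinal (ltnW n1) else Ordinal n1.
have ji : j != i.
  by rewrite /j; case: (eqVneq i (Ordinal n1)) => [->|]; rewrite // eq_sym.
have /connectP[[|k p] /= ] := connected_e i j; first by move=> _ jE; rewrite jE eqxx in ji.
move=> /andP[ik _] _; rewrite -(ltr_nat R) degreeE (bigD1 k) //= ik.
by rewrite ltr_wpDr // sumr_ge0.
Qed.

Lemma degree_le_dmax i : (degree e i <= dmax e)%N.
Proof. exact: leq_bigmax. Qed.

Lemma dmin_le_degree i : (dmin e <= degree e i)%N.
Proof.
rewrite /dmin; have := mem_index_enum i.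
elim: (index_enum _) => // j r IH; rewrite inE big_cons geq_min.
by case/orP => [/eqP ->|/IH ->]; rewrite ?leqnn ?orbT.
Qed.

Lemma dmin_gt0 : (0 < dmin e)%N.
Proof.
rewrite /dmin; elim/big_ind: _ => [|x y x0 y0|i _].
- exact: ltnW.
- by rewrite leq_min x0.
- exact: degree_gt0.
Qed.

Lemma dmin_le_dmax : (dmin e <= dmax e)%N.
Proof.
pose i : 'I_n := Ordinal n1.
exact: leq_trans (dmin_le_degree i) (degree_le_dmax i).
Qed.

(** The factors [1 / (d_i + 1)] of the [y]-update. *)
Definition averaging : 'M[R]_n :=
  diag_mx (\row_i ((degree e i)%:R + 1)^-1).

(** The composition of a dual step with the transposed constraint:
    [A p] changes by [c *: coupling *m x] in one iteration. *)
Definition coupling : 'M[R]_n := A *m averaging *m A.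

(** The penalty term linearised around the previous iterate: the decoupled
    Hessian [Q] minus the part that the multiplier update already accounts
    for. *)
Definition proximal : 'M[R]_n :=
  diag_mx (\row_i \sum_(j in nbh e i) A j i ^+ 2) - coupling.

Lemma mulmx_averaging v i :
  (averaging *m v) i 0 = ((degree e i)%:R + 1)^-1 * v i 0.
Proof. by rewrite /averaging mul_diag_mx !mxE. Qed.

Lemma coupling_form v : dot v (coupling *m v) =
  \sum_i ((degree e i)%:R + 1)^-1 * (A *m v) i 0 ^+ 2.
Proof.
rewrite /coupling -!mulmxA -(dot_sym _ _ laplacian_sym).
by apply: eq_bigr => i _; rewrite mulmx_averaging mulrCA expr2.
Qed.

Lemma coupling_psd : psd coupling.
Proof.
split=> [|v].
  by rewrite /coupling !trmx_mul laplacian_sym /averaging tr_diag_mx mulmxA.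
rewrite coupling_form; apply: sumr_ge0 => i _.
by rewrite mulr_ge0 ?sqr_ge0 // invr_ge0 addr_ge0.
Qed.

Lemma coupling_ge v : dot ones v = 0 ->
  a ^+ 2 / ((dmax e)%:R + 1) * dot v v <= dot v (coupling *m v).
Proof.
move=> v1; rewrite coupling_form mulrAC.
have d0 : 0 < (dmax e)%:R + 1 :> R by rewrite ltr_wpDl.
rewrite ler_pdivrMr //; apply: (le_trans (algebraic_connectivity_le_norm v1)).
rewrite mulr_suml; apply: ler_sum => i _; rewrite -expr2 mulrAC.
rewrite ler_peMl ?sqr_ge0 // mulrC ler_pdivlMr ?ltr_wpDl // mul1r lerD2r.
by rewrite ler_nat degree_le_dmax.
Qed.

Lemma coupling_kernel : kernel_ones coupling.
Proof.
have [A1 _] := laplacian_kernel; have [a0 _] := algebraic_connectivity_gap.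
split=> [|v Sv v1]; first by rewrite /coupling -mulmxA A1 mulmx0.
apply: dot_eq0; apply/eqP; rewrite eq_le dot_ge0 andbT.
have := coupling_ge v1; rewrite Sv dot0r pmulr_rle0 //.
by rewrite divr_gt0 ?exprn_gt0 // ltr_wpDl.
Qed.

Lemma proximal_form v : dot v (proximal *m v) =
  \sum_i (\sum_(j in nbh e i) A j i ^+ 2) * v i 0 ^+ 2
  - dot v (coupling *m v).
Proof.
rewrite mulmxBl !dotE; congr (_ - _).
by apply: eq_bigr => i _; rewrite mul_diag_mx !mxE mulrCA expr2.
Qed.

(** The square of the sum over the closed neighbourhood of [i] is at most
    [d_i + 1] times the sum of squares, and the weight [1 / (d_i + 1)] cancels
    this factor; exchanging the sums gives the diagonal part. *)
Lemma proximal_psd : psd proximal.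
Proof.
have symA i j : A i j = A j i by rewrite -{1}laplacian_sym mxE.
split=> [|v].
  by rewrite linearB /= tr_diag_mx (proj1 coupling_psd).
rewrite proximal_form subr_ge0 coupling_form.
have -> : \sum_i (\sum_(j in nbh e i) A j i ^+ 2) * v i 0 ^+ 2 =
    \sum_i \sum_(j in nbh e i) (A i j * v j 0) ^+ 2.
  rewrite (eq_bigr (fun i => \sum_j (A j i * v i 0) ^+ 2)) => [|i _].
    by rewrite exchange_big; apply: eq_bigr => i _;
      rewrite (@sum_nbh_laplacian i (fun x j => (x * v j 0) ^+ 2)) // => j;
      rewrite mul0r expr0n.
  rewrite (eq_bigr (fun j => A i j ^+ 2)) => [|j _]; last by rewrite symA.
  rewrite (@sum_nbh_laplacian i (fun x _ => x ^+ 2)) ?expr0n // mulr_suml.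
  by apply: eq_bigr => j _; rewrite symA exprMn.
apply: ler_sum => i _; rewrite mxE.
rewrite -(@sum_nbh_laplacian i (fun x j => x * v j 0)); last first.
  by move=> j; rewrite mul0r.
have d0 : 0 < (degree e i)%:R + 1 :> R by rewrite ltr_wpDl.
rewrite ler_pdivrMl //; apply: (le_trans (sqr_sum_le _ _)).
by rewrite card_nbh -natr1.
Qed.

Lemma sum_nbh_sqr i : \sum_(j in nbh e i) A j i ^+ 2 =
  (degree e i)%:R ^+ 2 + (degree e i)%:R.
Proof.
have symA j : A j i = A i j by rewrite -{1}laplacian_sym mxE.
have [_ irr] := simple_e.
rewrite (eq_bigr (fun j => A i j ^+ 2)) => [|j _]; last by rewrite symA.
rewrite (@sum_nbh_laplacian i (fun x _ => x ^+ 2)) ?expr0n //.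
rewrite (bigD1 i) //= [RHS]addrC addrC laplacianE eqxx mul1r irr subr0.
congr (_ + _); rewrite degreeE [RHS](bigD1 i) //= irr add0r.
apply: eq_bigr => j ji; rewrite laplacianE eq_sym (negbTE ji) mul0r sub0r.
by rewrite sqrrN -natrX; case: (e i j).
Qed.

Lemma proximal_diag_le v :
  \sum_i (\sum_(j in nbh e i) A j i ^+ 2) * v i 0 ^+ 2 <=
  ((dmax e)%:R ^+ 2 + (dmax e)%:R) * dot v v.
Proof.
rewrite mulr_sumr; apply: ler_sum => i _; rewrite -expr2 ler_wpM2r ?sqr_ge0 //.
rewrite sum_nbh_sqr -!natrX -!natrD ler_nat leq_add ?degree_le_dmax //.
by rewrite leq_exp2r ?degree_le_dmax.
Qed.

Lemma proximal_le v : dot v (proximal *m v) <=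
  ((dmax e)%:R ^+ 2 + (dmax e)%:R) * dot v v.
Proof.
apply: le_trans (proximal_diag_le v); rewrite proximal_form lerBlDr lerDl.
exact: (proj2 coupling_psd).
Qed.

(** Both sides bound the form of [coupling] at a unit vector orthogonal to
    [ones]. *)
Lemma coupling_gap_le :
  a ^+ 2 / ((dmax e)%:R + 1) <= (dmax e)%:R ^+ 2 + (dmax e)%:R.
Proof.
have [v [v1 v0] _] := rayleigh_minimum A n1.
have := coupling_ge v0; rewrite v1 mulr1 => /le_trans; apply.
have := proj2 proximal_psd v; rewrite proximal_form subr_ge0 => /le_trans; apply.
by have := proximal_diag_le v; rewrite v1 mulr1.
Qed.

End GraphLaplacian.

(** * The separable objective *)

Section Extrema.
Context {R : realType} {n : nat} (hn : (0 < n)%N).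
Implicit Types h : 'I_n -> R.

Lemma family_min_gt0 h : (forall i, 0 < h i) -> 0 < family_min hn h.
Proof. by move=> h0; apply: lt_bigmin. Qed.

Lemma family_min_le h i : family_min hn h <= h i.
Proof. exact: bigmin_le. Qed.

Lemma family_max_ge h i : h i <= family_max hn h.
Proof. exact: le_bigmax. Qed.

End Extrema.

Section Gradient.
Context {R : realType} {n : nat} (f : 'I_n -> R -> R).
Implicit Types (x y : 'cV[R]_n).

Definition gradient x : 'cV[R]_n := \col_i derive1 (f i) (x i 0).

Hypothesis df : forall i (x : R), derivable (f i) x 1.

Lemma dot_gradient x y : dot x (gradient y) =
  \sum_i x i 0 * derive1 (f i) (y i 0).
Proof. by apply: eq_bigr => i _; rewrite mxE. Qed.

Lemma gradient_strongly_monotone (nu : R) (nuf : 'I_n -> R) x y :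
  (forall i, nu <= nuf i) -> (forall i, strongly_convex (nuf i) (f i)) ->
  nu * dot (x - y) (x - y) <= dot (x - y) (gradient x - gradient y).
Proof.
move=> nu_le cf; rewrite mulr_sumr; apply: ler_sum => i _; rewrite !mxE -expr2.
apply: le_trans (strongly_convex_monotone _ _ (@df i) (cf i)).
by rewrite ler_wpM2r ?sqr_ge0.
Qed.

Lemma gradient_cocoercive (L : R) (Lf nuf : 'I_n -> R) x y :
  (forall i, Lf i <= L) -> (forall i, 0 <= Lf i) ->
  (forall i, (Lf i).-lipschitz (derive1 (f i))) ->
  (forall i, 0 < nuf i) -> (forall i, strongly_convex (nuf i) (f i)) ->
  dot (gradient x - gradient y) (gradient x - gradient y) <=
  L * dot (x - y) (gradient x - gradient y).
Proof.
move=> le_L Lf0 lip nuf0 cf; rewrite mulr_sumr; apply: ler_sum => i _.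
rewrite !mxE -expr2.
have mono : 0 <= (x i 0 - y i 0) *
    (derive1 (f i) (x i 0) - derive1 (f i) (y i 0)).
  apply: le_trans (strongly_convex_monotone _ _ (@df i) (cf i)).
  by rewrite mulr_ge0 ?sqr_ge0 // ltW.
apply: (le_trans (lipschitz_cocoercive (Lf0 i) (lip i) mono)).
by rewrite ler_wpM2r.
Qed.

Lemma strong_convexity_le_lipschitz (nu L : R) i :
  strongly_convex nu (f i) -> L.-lipschitz (derive1 (f i)) -> nu <= L.
Proof.
move=> cf lip; have := strongly_convex_monotone 1 0 (@df i) cf.
have := lip (1, 0) (conj I I) => /=.
rewrite subr0 normr1 mulr1 expr1n mulr1 mul1r => h1 h2.
by apply: (le_trans h2); apply: le_trans h1; exact: ler_norm.
Qed.

(** The feasible points are the constant vectors, so the objective restricted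
    to them is [fun r => \sum_i f i r], whose derivative is the sum of the
    components of the gradient. *)
Lemma optimal_stationary (A : 'M[R]_n) xs : (0 < n)%N -> kernel_ones A ->
  optimal_solution f A xs -> dot ones (gradient xs) = 0.
Proof.
move=> n0 kA [Axs opt]; have [A1 _] := kA.
have [s xsE] : exists s, xs = s *: ones.
  by eexists; exact: kernel_onesE n0 kA Axs.
have xsi i : xs i 0 = s by rewrite xsE !mxE mulr1.
pose h : R -> R := \sum_(i < n) f i.
have hE r : h r = objective f (r *: ones).
  by rewrite /h fct_sumE; apply: eq_bigr => i _; rewrite !mxE mulr1.
have dh (r : R) : is_derive r 1 h (\sum_(i < n) derive1 (f i) r).
  by apply: is_derive_sum => i; rewrite derive1E; exact/derivableP.
have := @derive1_argmin R h s
  (fun r => @ex_derive _ _ _ _ _ _ _ (dh r)) _.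
rewrite derive1E derive_val dot_gradient => hs.
rewrite -[RHS]hs; last first.
  by move=> r; rewrite !hE -xsE; apply: opt; rewrite -scalemxAr A1 scaler0.
by apply: eq_bigr => i _; rewrite mxE mul1r xsi.
Qed.

End Gradient.

(** * Runs of the algorithm *)

Section Run.
Context {R : realType} {n : nat} (f : 'I_n -> R -> R) (e : rel 'I_n) (c : R)
  (x y p : nat -> 'cV[R]_n).
Hypotheses (n1 : (1 < n)%N) (simple_e : simple_graph e)
  (connected_e : connected_graph e)
  (df : forall i (x : R), derivable (f i) x 1)
  (run : admm_run f e (laplacian e R) c x y p).

Local Notation A := (laplacian e R).
Local Notation B1 := (averaging e).
Local Notation S := (coupling e).
Local Notation M := (proximal e).

Lemma run_y t : y t.+1 = B1 *m (A *m x t.+1).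
Proof.
apply/colP => i; have [_ -> _] := run t i; rewrite mulmx_averaging mxE.
congr (_ * _).
by rewrite (@sum_nbh_laplacian _ _ _ simple_e i (fun a j => a * x t.+1 j 0)) // => j;
  rewrite mul0r.
Qed.

Lemma run_p t : p t.+1 = p t + c *: (B1 *m (A *m x t.+1)).
Proof.
apply/colP => i; have [_ _ ->] := run t i.
by rewrite -run_y !mxE.
Qed.

(** The local problem, expanded in powers of the unknown, is a quadratic
    perturbation of [f i]. *)
Lemma run_gradient t i :
  derive1 (f i) (x t.+1 i 0) + (A *m (p t + c *: y t)) i 0 +
  c * (\sum_(j in nbh e i) A j i ^+ 2) * (x t.+1 i 0 - x t i 0) = 0.
Proof.
have symA j : A j i = A i j.
  by have /matrixP/(_ i j) := laplacian_sym (R := R) simple_e; rewrite mxE.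
have [xmin _ _] := run t i.
set X := x t i 0 in xmin *; set Z := x t.+1 i 0 in xmin *.
pose b := \sum_(j in nbh e i)
  (p t j 0 * A j i + c * (y t j 0 - A j i * X) * A j i).
pose q := \sum_(j in nbh e i) c / 2 * A j i ^+ 2.
pose k := \sum_(j in nbh e i) c / 2 * (y t j 0 - A j i * X) ^+ 2.
have objE w : \sum_(j in nbh e i) (p t j 0 * A j i * w +
    c / 2 * `|y t j 0 + A j i * (w - X)| ^+ 2) = b * w + q * w ^+ 2 + k.
  rewrite /b /q /k !mulr_suml -!big_split /=; apply: eq_bigr => j _.
  by rewrite real_normK ?num_real //; field.
have zmin : is_argmin (fun w => f i w + (b * w + q * w ^+ 2)) Z.
  by move=> w; have := xmin w; rewrite !objE !addrA lerD2r.
rewrite -[RHS](argmin_quadratic_perturbation (@df i) zmin) -addrA; congr (_ + _).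
rewrite mxE -(@sum_nbh_laplacian _ _ _ simple_e i
  (fun a j => a * (p t + c *: y t) j 0)) => [|j]; last by rewrite mul0r.
rewrite /b /q !mulr_sumr !mulr_suml -!big_split /=; apply: eq_bigr => j _.
by rewrite -symA !mxE; field.
Qed.

(** The step index is shifted by one because [y t] is the local average of
    [A *m x t] only for [0 < t]; the initial [y 0] is arbitrary. *)
Lemma run_step t :
  gradient f (x t.+2) + A *m p t.+2 + c *: (M *m (x t.+2 - x t.+1)) = 0.
Proof.
apply/colP => i; rewrite [RHS]mxE -[RHS](run_gradient t.+1 i).
have -> : A *m p t.+2 =
    A *m (p t.+1 + c *: y t.+1) + c *: (S *m (x t.+2 - x t.+1)).
  rewrite run_p run_y /coupling !mulmxBr !mulmxDr -!scalemxAr -!mulmxA scalerBr.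
  by rewrite -addrA [X in _ = _ + X]addrC subrK.
rewrite /proximal mulmxBl scalerBr mul_diag_mx !mxE.
by ring.
Qed.

(** The dual error [u] of the recursion is built along the run: it starts from
    a preimage under [coupling] and accumulates the centred primal errors, which
    keeps both the equation for [A *m p] and the zero mean. *)
Lemma run_linear_decay (theta sigma nu L K : R) (Lf nuf : 'I_n -> R) xs :
  optimal_solution f A xs ->
  (forall i, nu <= nuf i) -> (forall i, 0 < nuf i) ->
  (forall i, strongly_convex (nuf i) (f i)) ->
  (forall i, Lf i <= L) -> (forall i, 0 <= Lf i) ->
  (forall i, (Lf i).-lipschitz (derive1 (f i))) ->
  (forall v, dot v (M *m v) <= theta * dot v v) ->
  (forall v, dot ones v = 0 -> sigma * dot v v <= dot v (S *m v)) ->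
  0 < c -> 1 <= K -> 0 < sigma -> 0 < nu ->
  c * theta = K * nu -> L = K * c * sigma -> theta <= K ^+ 2 * sigma ->
  exists2 B : R, 0 <= B &
    forall m, nu * norm2 (x m.+2 - xs) ^+ 2 <= expR (- (m%:R / (6 * K))) * B.
Proof.
move=> opt nu_le nuf0 cf le_L Lf0 lip M_le S_ge c0 K1 sigma0 nu0 cE LE thetaK.
have n0 : (0 < n)%N := ltnW n1.
have psdA := laplacian_psd (R := R) simple_e; have [sA _] := psdA.
have kA := laplacian_kernel (R := R) n1 simple_e connected_e.
have psdS := coupling_psd (R := R) simple_e; have [sS _] := psdS.
have kS := coupling_kernel (R := R) n1 simple_e connected_e.
have psdM := proximal_psd (R := R) simple_e.
have gs0 := optimal_stationary df n0 kA opt.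
have [u0 u0E u01] : exists2 u, S *m u = A *m p 1%N + gradient f xs &
    dot ones u = 0.
  by apply: range_kernel_ones => //; rewrite dotDr gs0 addr0 dot_ones_mulmx.
pose err t := x t - xs.
have A_err t : A *m x t = A *m err t.
  by rewrite mulmxBr (proj1 opt) subr0.
have [U [U_0 UE]] : exists U : nat -> 'cV[R]_n,
    U 0 = u0 /\ forall m, U m.+1 = U m + c *: center (err m.+2).
  by exists (fix U m := if m is k.+1 then U k + c *: center (err k.+2) else u0).
have U1 m : dot ones (U m) = 0.
  by elim: m => [|m IH]; rewrite ?U_0 ?UE // dotDr dotZr IH dot_ones_center // mulr0 addr0.
have SU m : S *m U m = A *m p m.+1 + gradient f xs.
  elim: m => [|m IH]; rewrite ?U_0 // UE run_p A_err.
  rewrite [A *m (p _ + _)]mulmxDr -scalemxAr !mulmxA.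
  rewrite mulmxDr IH -scalemxAr mulmx_center ?(proj1 kS) //.
  by rewrite addrAC.
pose W m := lyapunov S M c K (err m.+1) (U m).
have step m : (1 + (5 * K)^-1) * W m.+1 <= W m /\
    nu * dot (err m.+2) (err m.+2) <= W m.
  apply: (lyapunov_contraction psdS psdM c0 K1 sigma0 nu0 M_le cE LE thetaK
    (w := center (err m.+2)) (g := gradient f (x m.+2) - gradient f xs)).
  - have -> : err m.+2 - err m.+1 = x m.+2 - x m.+1.
      by rewrite /err opprB addrA subrK.
    rewrite SU -[RHS](run_step m); congr (_ + _).
    by rewrite addrA addrAC subrK.
  - exact: UE.
  - by rewrite mulmx_center ?(proj1 kS).
  - exact: dot_center_le.
  - exact: S_ge.
  - by have := gradient_strongly_monotone df (x m.+2) xs nu_le cf.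
  - by have := gradient_cocoercive df (x m.+2) xs le_L Lf0 lip nuf0 cf.
have W0 m : 0 <= W m.
  by apply: le_trans (proj2 (step m)); rewrite mulr_ge0 ?dot_ge0 ?(ltW nu0).
exists (W 0%N); first exact: W0.
move=> m; rewrite norm2_dot sqr_sqrtr ?dot_ge0 //.
apply: (le_trans (proj2 (step m))).
by apply: geometric_decay => // k; case: (step k).
Qed.

End Run.

(** * The penalty parameter and the rate *)

Section PenaltyParameter.
Context {R : realType}.

Lemma penalty_constants (theta sigma nu L : R) :
  0 < sigma -> sigma <= theta -> 0 < nu -> nu <= L ->
  let K : R := Num.sqrt (L / nu * (theta / sigma)) in
  let c : R := K * nu / theta in
  [/\ 0 < c, 1 <= K, c * theta = K * nu, L = K * c * sigma &
      theta <= K ^+ 2 * sigma].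
Proof.
move=> sigma0 st nu0 nuL K c.
have theta0 : 0 < theta by exact: lt_le_trans st.
have k1 : 1 <= L / nu by rewrite ler_pdivlMr // mul1r.
have r1 : 1 <= theta / sigma by rewrite ler_pdivlMr // mul1r.
have kr1 : 1 <= L / nu * (theta / sigma) by exact: mulr_ege1.
have K1 : 1 <= K by rewrite -sqrtr1 ler_sqrt // (le_trans ler01).
have K2 : K ^+ 2 = L / nu * (theta / sigma) by rewrite sqr_sqrtr // (le_trans ler01).
split => //.
- by rewrite divr_gt0 // mulr_gt0 // (lt_le_trans ltr01).
- by rewrite /c; field; rewrite gt_eqF.
- rewrite /c (_ : _ * sigma = K ^+ 2 * (nu * sigma / theta)); last by field; rewrite gt_eqF.
  by rewrite K2; field; rewrite !gt_eqF.
- rewrite K2 -mulrA divfK ?gt_eqF //.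
  by rewrite ler_peMl // ltW.
Qed.

(** Two factors [1 + 1 / D <= 2] give [4 * D ^+ 3], and [D ^+ 3] is at most
    [D ^+ 4 / d]. *)
Lemma degree_ratio_bound (D d a kappa : R) :
  0 <= kappa -> 1 <= d -> d <= D -> 0 < a ->
  Num.sqrt (kappa * ((D ^+ 2 + D) / (a ^+ 2 / (D + 1)))) <=
  2 * (Num.sqrt kappa * Num.sqrt (D ^+ 4 / (d * a ^+ 2))).
Proof.
move=> k0 d1 dD a0.
have D1 : 1 <= D by exact: le_trans dD.
have D0 : 0 < D by exact: lt_le_trans D1.
have d0 : 0 < d by exact: lt_le_trans d1.
rewrite sqrtrM // mulrCA ler_wpM2l ?sqrtr_ge0 //.
have -> : 2 = Num.sqrt (2 ^+ 2) :> R by rewrite sqrtr_sqr ger0_norm.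
rewrite -sqrtrM ?sqr_ge0 //; apply: ler_wsqrtr.
have -> : (D ^+ 2 + D) / (a ^+ 2 / (D + 1)) = (D ^+ 2 + D) * (D + 1) * d / (d * a ^+ 2).
  by field; rewrite !gt_eqF // addr_gt0.
have da0 : 0 <= (d * a ^+ 2)^-1 by rewrite invr_ge0 mulr_ge0 ?sqr_ge0 ?(ltW d0).
rewrite [leRHS]mulrA ler_wpM2r //.
apply: (@le_trans _ _ ((D ^+ 2 + D) * (D + 1) * D)).
  by rewrite ler_wpM2l // mulr_ge0 // addr_ge0 ?sqr_ge0 ?(ltW D0).
rewrite (_ : 2 ^+ 2 * D ^+ 4 = (D ^+ 2 + D ^+ 2) * (D + D) * D); last by ring.
rewrite ler_wpM2r ?(ltW D0) // ler_pM ?addr_ge0 ?sqr_ge0 ?(ltW D0) //.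
  by rewrite lerD2l expr2 ler_peMl // ltW.
by rewrite lerD2l.
Qed.

End PenaltyParameter.

Theorem proposition4 (R : realType) :
  exists C : R, 0 < C /\
  forall (n : nat) (hn : (1 < n)%N) (e : rel 'I_n)
    (f : 'I_n -> R -> R) (nuf Lf : 'I_n -> R) (xs : 'cV[R]_n),
  simple_graph e ->
  connected_graph e ->
  (forall i, convex_function [set: R] (f i)) ->
  (forall i (x : R), derivable (f i) x 1) ->
  (forall i, 0 <= Lf i) ->
  (forall i, (Lf i).-lipschitz (derive1 (f i))) ->
  (forall i, 0 < nuf i) ->
  (forall i, strongly_convex (nuf i) (f i)) ->
  optimal_solution f (laplacian e R) xs ->
  let nu := family_min (ltnW hn) nuf in
  let L := family_max (ltnW hn) Lf in
  let kappa := L / nu in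
  let a := algebraic_connectivity e R in
  exists c : R, 0 < c /\
  forall x y p : nat -> 'cV[R]_n,
  admm_run f e (laplacian e R) c x y p ->
  \forall eps \near (0 : R)^'+, forall t : nat,
    C * (Num.sqrt kappa *
         Num.sqrt ((dmax e)%:R ^+ 4 / ((dmin e)%:R * a ^+ 2)) *
         ln (1 / eps)) <= t%:R ->
    norm2 (x t - xs) <= eps.
Proof.
exists 36; split => // n hn e f nuf Lf xs simple_e connected_e _ df Lf0 lip nuf0
  cf opt nu L kappa a.
have nu0 : 0 < nu by exact: family_min_gt0.
have nu_le i : nu <= nuf i by exact: family_min_le.
have le_L i : Lf i <= L by exact: family_max_ge.
have nuL : nu <= L.
  pose i := Ordinal hn; apply: (le_trans (nu_le i)); apply: le_trans (le_L i).
  exact: (strong_convexity_le_lipschitz df (cf i) (lip i)).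
have [a0 _] : 0 < a /\ _ := algebraic_connectivity_gap hn simple_e connected_e.
pose D : R := (dmax e)%:R; pose d : R := (dmin e)%:R.
have d1 : 1 <= d by rewrite ler1n dmin_gt0.
have dD : d <= D by rewrite ler_nat dmin_le_dmax.
have D0 : 0 < D by rewrite (lt_le_trans ltr01) // (le_trans d1).
pose theta := D ^+ 2 + D; pose sigma := a ^+ 2 / (D + 1).
have sigma0 : 0 < sigma by rewrite divr_gt0 ?exprn_gt0 // addr_gt0.
have st : sigma <= theta by exact: coupling_gap_le.
have [] := penalty_constants sigma0 st nu0 nuL.
set K := Num.sqrt _; set c := K * nu / theta => c0 K1 cE LE thetaK.
exists c; split => // x y p run.
have [B B0 dec] := run_linear_decay hn simple_e connected_e df run opt nu_le nuf0
  cf le_L Lf0 lip (proximal_le simple_e) (coupling_ge hn simple_e connected_e)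
  c0 K1 sigma0 nu0 cE LE thetaK.
apply: (linear_rate_complexity K1 _ nu0 B0 _ dec) => [|t]; last exact: sqrtr_ge0.
apply: degree_ratio_bound => //.
by rewrite divr_ge0 // ltW // (lt_le_trans nu0).
Qed.
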